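(* Let $(A,\wedge,1)$ be a bounded semilattice, endowed with the hemiimplicative semilattice structure $(A,\wedge,\to,1)$ in which $a\to b=1$ if $a\le b$ and $a\to b=a\wedge b$ if $a\not\leq b$. Let $F$ be a filter of $(A,\wedge,\to,1)$. Then $F$ is congruent if and only if it satisfies the following conditions for every $x,y\in A$ and $f\in F$: (1) If $x\not\leq y$ and $x\wedge f\le y\wedge f$, then $x\wedge y\in F$. (2) If $x\not\leq y$, $x\wedge f\not\leq y\wedge f$ and $x\wedge y\not\leq f$, then $x\wedge y\in F$.
   Context: A bounded semilattice $(A,\wedge,1)$ is a meet-semilattice with greatest element $1$, ordered by $a\le b$ iff $a\wedge b=a$. A hemiimplicative semilattice is an algebra $(A,\wedge,\to,1)$ such that $(A,\wedge,1)$ is a bounded semilattice, $a\to a=1$ for all $a$, and $a\le b\to c$ implies $a\wedge b\le c$. In it, $a\leftrightarrow b:=(a\to b)\wedge(b\to a)$ and $t(a,b,f):=(a\to b)\leftrightarrow((a\wedge f)\to(b\wedge f))$. A filter is a subset $F\subseteq A$ with $1\in F$, closed under $\wedge$, and upward closed. A filter $F$ is congruent if $t(a,b,f)\in F$ for every $a,b\in A$ and $f\in F$. *)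

(* Defs.v *)
From HB Require Import structures.
From mathcomp Require Import all_boot all_order.
From mathcomp Require Import boolp classical_sets.

Set Implicit Arguments.
Unset Strict Implicit.
Unset Printing Implicit Defensive.

Import Order.Theory.
Local Open Scope order_scope.

(* Bounded semilattices are the library's [tMeetSemilatticeType]s, whose order
   satisfies [leEmeet : (x <= y) = (x `&` y == x)]. *)

Record hemiImplicative (d : Order.disp_t) (A : tMeetSemilatticeType d) :=
  HemiImplicative {
    himp :> A -> A -> A;
    himp_refl : forall a : A, himp a a = \top;
    himp_mp : forall a b c : A, a <= himp b c -> a `&` b <= c
  }.

Section HemiImplicativeTheory.
Variables (d : Order.disp_t) (A : tMeetSemilatticeType d).
Implicit Types (H : hemiImplicative A) (F : set A) (a b f : A).

Definition hiff H a b : A := H a b `&` H b a.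

Definition hterm H a b f : A := hiff H (H a b) (H (a `&` f) (b `&` f)).

Record is_filter F : Prop := IsFilter {
  filter_top : F \top;
  filter_meet : forall a b, F a -> F b -> F (a `&` b);
  filter_up : forall a b, F a -> a <= b -> F b
}.

Definition congruent H F : Prop :=
  forall a b f, F f -> F (hterm H a b f).

Definition meet_imp a b : A := if a <= b then \top else a `&` b.

Lemma meet_imp_refl a : meet_imp a a = \top.
Proof. by rewrite /meet_imp lexx. Qed.

Lemma meet_imp_mp a b c : a <= meet_imp b c -> a `&` b <= c.
Proof.
rewrite /meet_imp; case: ifP => [le_bc _ | _ le_a].
  exact: le_trans (leIr _ _) le_bc.
apply: le_trans (leIl _ _) _; exact: le_trans le_a (leIr _ _).
Qed.

Definition meet_hemiimplicative : hemiImplicative A :=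
  HemiImplicative meet_imp_refl meet_imp_mp.

End HemiImplicativeTheory.

Arguments meet_hemiimplicative {d} A.

(* Main.v *)
(* For this implication [a <-> b] is [1] if [a = b] and [a /\ b] otherwise, so
   [t(x, y, f)] takes only the values [1], [x /\ y] and [x /\ y /\ f]; for [f]
   in the filter, the last two belong to it simultaneously. Conditions (1) and
   (2) are the cases in which the value is not [1]. *)

Require Import Defs.
From HB Require Import structures.
From mathcomp Require Import all_boot all_order.
From mathcomp Require Import boolp classical_sets.

Set Implicit Arguments.
Unset Strict Implicit.
Unset Printing Implicit Defensive.

Import Order.Theory.
Local Open Scope order_scope.

Lemma hiff_meet_impE (d : Order.disp_t) (A : tMeetSemilatticeType d) (a b : A) :
  hiff (meet_hemiimplicative A) a b = if a == b then \top else a `&` b.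
Proof.
rewrite /hiff /= /meet_imp eq_le.
case: (a <= b); case: (b <= a) => /=.
- exact: meetx1.
- by rewrite meet1x meetC.
- exact: meetx1.
- by rewrite (meetC b) meetxx.
Qed.

Lemma hterm_meet_impE (d : Order.disp_t) (A : tMeetSemilatticeType d)
    (x y f : A) :
  hterm (meet_hemiimplicative A) x y f =
  if x <= y then \top
  else if x `&` f <= y `&` f then x `&` y
  else if x `&` y <= f then \top else x `&` y `&` f.
Proof.
rewrite /hterm hiff_meet_impE /= /meet_imp.
case: (boolP (x <= y)) => [le_xy|_] /=.
  by rewrite (leI2 le_xy (lexx f)) eqxx.
case: (x `&` f <= y `&` f).
  (* The second implication is [\top], so the equality test asks whether [x]&[y] is [\top]; both
     branches then yield [x]&[y]. *)
  by rewrite meetx1; case: eqP => [->|].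
(* Both implications are now meets, [x]&[y] and [x]&[y]&[f]; they coincide exactly when
   [x]&[y <= f]. *)
by rewrite meetACA meetxx meetA meetxx leEmeet eq_sym.
Qed.

Theorem proposition4p8 (d : Order.disp_t) (A : tMeetSemilatticeType d)
    (F : set A) (hF : is_filter F) :
  congruent (meet_hemiimplicative A) F <->
  (forall x y f : A, F f ->
     (~~ (x <= y) -> x `&` f <= y `&` f -> F (x `&` y)) /\
     (~~ (x <= y) -> ~~ (x `&` f <= y `&` f) -> ~~ (x `&` y <= f) ->
        F (x `&` y))).
Proof.
case: hF => F1 FI Fup; split=> [congF x y f Ff | condF x y f Ff].
  have := congF x y f Ff; rewrite hterm_meet_impE.
  case: (x <= y) => //; case: (x `&` f <= y `&` f) => //.
  case: (x `&` y <= f) => // Fxyf; split=> // _ _ _.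
  (* Only here does the value of the term lie below [x]&[y]; upward closure removes the factor
     [f]. *)
  exact: Fup Fxyf (leIl _ _).
have [cond1 cond2] := condF x y f Ff; rewrite hterm_meet_impE.
case: ifP => // /negbT nle_xy; case: ifP => [le_f|/negbT nle_f].
  exact: cond1.
by case: ifP => // /negbT nle_xyf; apply: FI => //; apply: cond2.
Qed.
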